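(* Let $\mathbb{K}$ be a field and let $M$ and $N$ be dg $\mathbb{K}[u]$-modules ($\deg u=2$) whose homologies are finitely generated $\mathbb{K}[u]$-modules. Suppose that $d_{\mathrm{CohI}}(M,N)=\varepsilon$ with $\varepsilon$ a (finite) real number. Then $\alpha M$ and $\alpha N$ are $\varepsilon$-homotopy interleaved, and they are not $\delta$-homotopy interleaved for any $\delta<\varepsilon$, in the category $\mathsf{Ch}_{\mathbb{K}}^{(\mathbb{R},\leq)}$.
   Context: A dg $\mathbb{K}[u]$-module is a cochain complex $M=\{M^l,\partial\}_{l\in\mathbb{Z}}$ of $\mathbb{K}$-vector spaces with a linear map $u:M^l\to M^{l+2}$ satisfying $u\partial=\partial u$. $\mathsf{Ch}_{\mathbb{K}}$ is the category of (unbounded) cochain complexes over $\mathbb{K}$ with quasi-isomorphisms as weak equivalences; $\mathcal{C}^{(\mathbb{R},\leq)}$ is the category of functors $(\mathbb{R},\leq)\to\mathcal{C}$; weak equivalences in $\mathsf{Ch}_{\mathbb{K}}^{(\mathbb{R},\leq)}$ are pointwise. $\alpha M\in\mathsf{Ch}_{\mathbb{K}}^{(\mathbb{R},\leq)}$ is given by $\alpha M(r)=\Sigma^{2\lfloor r\rfloor}M$, where $(\Sigma^lA)^i=A^{i+l}$, with structure map $\alpha M(r\to s)$ the multiplication by $u^{\lfloor s\rfloor-\lfloor r\rfloor}$. For $k\in\{0,1\}$, $\nu^kM(r)=H^{k+2\lfloor r\rfloor}(M)$, with structure maps induced by multiplication by powers of $u$. Interleavings: with $F^{\varepsilon}(a)=F(a+\varepsilon)$,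 $F,G\in\mathcal{C}^{(\mathbb{R},\leq)}$ are $\varepsilon$-interleaved ($\varepsilon\geq 0$) if there are natural transformations $\varphi:F\to G^{\varepsilon}$, $\psi:G\to F^{\varepsilon}$ with $\psi^{\varepsilon}\varphi$ and $\varphi^{\varepsilon}\psi$ equal to the structure transformations $F\to F^{2\varepsilon}$, $G\to G^{2\varepsilon}$; $d_{\mathrm I}(F,G)$ is the infimum in $[0,\infty]$ of such $\varepsilon$. $d_{\mathrm{CohI}}(M,N)=\max_{k=0,1}d_{\mathrm I}(\nu^kM,\nu^kN)$. Objects $X,Y$ of $\mathsf{Ch}_{\mathbb{K}}^{(\mathbb{R},\leq)}$ are $\varepsilon$-homotopy interleaved if there are objects $X',Y'$, connected to $X$ and $Y$ respectively by zigzags of weak equivalences, which are $\varepsilon$-interleaved in $\mathsf{Ch}_{\mathbb{K}}^{(\mathbb{R},\leq)}$. *)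

(* Defs.v *)
From HB Require Import structures.
From mathcomp Require Import all_boot all_order all_algebra.
From mathcomp Require Import boolp classical_sets reals constructive_ereal ereal.
From Stdlib Require Import Relation_Operators.
From mathcomp Require Import zify.

Set Implicit Arguments.
Unset Strict Implicit.
Unset Printing Implicit Defensive.

Import Order.TTheory GRing.Theory Num.Theory.

Local Open Scope ring_scope.

Record category := Category {
  ob :> Type;
  hom : ob -> ob -> Type;
  idm : forall a, hom a a;
  compm : forall a b c, hom b c -> hom a b -> hom a c;
  comp_idl : forall a b (f : hom a b), compm (idm b) f = f;
  comp_idr : forall a b (f : hom a b), compm f (idm a) = f;
  compA : forall a b c d (h : hom c d) (g : hom b c) (f : hom a b),
    compm h (compm g f) = compm (compm h g) f }.

Arguments idm {C} a : rename.
Arguments compm {C a b c} _ _ : rename.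

Record rfun (R : realType) (C : category) := RFun {
  robj :> R -> C;
  rmap : forall r s, r <= s -> hom (robj r) (robj s);
  rmap_id : forall r (h : r <= r), rmap h = idm (robj r);
  rmap_comp : forall r s t (h1 : r <= s) (h2 : s <= t) (h3 : r <= t),
    compm (rmap h2) (rmap h1) = rmap h3 }.

Arguments rmap {R C} F [r s] _ : rename.

Record nat_trans (R : realType) (C : category) (F G : rfun R C) := NatTrans {
  ntval :> forall r, hom (F r) (G r);
  nt_nat : forall r s (h : r <= s),
    compm (ntval s) (rmap F h) = compm (rmap G h) (ntval r) }.

Section Interleavings.
Variables (R : realType) (C : category).
Implicit Types (F G : rfun R C) (e : R).

Lemma rshift_le e (r s : R) : r <= s -> r + e <= s + e.
Proof. by rewrite lerD2r. Qed.

Definition rshift e F : rfun R C.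
Proof.
refine (@RFun R C (fun r => F (r + e))
  (fun r s h => rmap F (rshift_le e h)) _ _).
- by move=> r h; exact: rmap_id.
- by move=> r s t h1 h2 h3; exact: rmap_comp.
Defined.

Definition nt_comp F G H (b : nat_trans G H) (a : nat_trans F G) :
  nat_trans F H.
Proof.
refine (@NatTrans R C F H (fun r => compm (b r) (a r)) _).
by move=> r s h; rewrite -compA nt_nat compA nt_nat compA.
Defined.

Definition nt_shift e F G (a : nat_trans F G) :
  nat_trans (rshift e F) (rshift e G).
Proof.
refine (@NatTrans R C (rshift e F) (rshift e G) (fun r => a (r + e)) _).
by move=> r s h; exact: (nt_nat a (rshift_le e h)).
Defined.

Lemma rstruct_le e (r : R) : 0 <= e -> r <= r + e + e.
Proof. by move=> e0; rewrite -addrA lerDl addr_ge0. Qed.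

(* The structure transformation F -> F^{2e}, where F^{2e} is written as
   (F^e)^e since r + 2e and (r + e) + e are not convertible. *)
Definition rstruct e (e0 : 0 <= e) F : nat_trans F (rshift e (rshift e F)).
Proof.
refine (@NatTrans R C F (rshift e (rshift e F))
  (fun r => rmap F (rstruct_le r e0)) _).
move=> r s h /=.
have h' : r <= s + e + e by exact: le_trans h (rstruct_le s e0).
by rewrite !(rmap_comp _ _ _ h').
Defined.

Definition interleaved e F G : Prop :=
  exists (e0 : 0 <= e)
    (phi : nat_trans F (rshift e G)) (psi : nat_trans G (rshift e F)),
    nt_comp (nt_shift e psi) phi = rstruct e0 F /\
    nt_comp (nt_shift e phi) psi = rstruct e0 G.

Definition dI F G : \bar R :=
  ereal_inf [set e%:E | e in [set e | interleaved e F G]]%classic.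

End Interleavings.

Section LinearMaps.
Variable K : fieldType.

Lemma linear_ext (U V : lmodType K) (f g : {linear U -> V}) : f =1 g -> f = g.
Proof.
case: f g => f cf [g cg] /= /funext fg; subst g; congr GRing.Linear.Pack.
case: cf cg => [[a] [b]] [[a'] [b']].
by rewrite (Prop_irrelevance a a') (Prop_irrelevance b b').
Qed.

Definition lin_id (U : lmodType K) : {linear U -> U} := idfun.

Definition lin_comp (U V W : lmodType K) (g : {linear V -> W})
  (f : {linear U -> V}) : {linear U -> W} := g \o f.

Definition Vect : category.
Proof.
refine (@Category (lmodType K) (fun U V => {linear U -> V})
  lin_id lin_comp _ _ _).
- by move=> *; exact: linear_ext.
- by move=> *; exact: linear_ext.
- by move=> *; exact: linear_ext.
Defined.

End LinearMaps.

Section QuotientSpace.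
Local Open Scope quotient_scope.
Variables (K : fieldType) (V : lmodType K) (W : submodClosed V).

Definition lquot_sub : {pred V} := W.

HB.instance Definition _ := GRing.isZmodClosed.Build V lquot_sub
  (GRing.submod_closedB (submodClosedP W)).

Definition lquot : Type := Quotient.quot lquot_sub.

HB.instance Definition _ := GRing.Zmodule.on lquot.
HB.instance Definition _ := EqQuotient.on lquot.

Definition lquot_pi (x : V) : lquot := \pi_(Quotient.quot lquot_sub) x.

Lemma lquot_piE x y : (lquot_pi x = lquot_pi y) <-> (x - y \in W).
Proof.
have -> : (x - y \in W) = (x == y %[mod Quotient.quot lquot_sub]).
  by rewrite -Quotient.idealrBE.
by split=> [/eqP|/eqP].
Qed.

Lemma lquot_piD x y : lquot_pi (x + y) = lquot_pi x + lquot_pi y.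
Proof. by rewrite /lquot_pi [in LHS]raddfD. Qed.

Lemma lquot_pi_repr (a : lquot) : lquot_pi (repr a) = a.
Proof. exact: reprK. Qed.

Definition lquot_scale (c : K) (a : lquot) : lquot := lquot_pi (c *: repr a).

Lemma lquot_piZ c x : lquot_scale c (lquot_pi x) = lquot_pi (c *: x).
Proof.
apply/lquot_piE; rewrite -scalerBr rpredZ //.
by apply/lquot_piE; exact: lquot_pi_repr.
Qed.

Lemma lquot_scalerA a b x :
  lquot_scale a (lquot_scale b x) = lquot_scale (a * b) x.
Proof. by rewrite -(lquot_pi_repr x) !lquot_piZ scalerA. Qed.

Lemma lquot_scale1r : left_id 1 lquot_scale.
Proof. by move=> x; rewrite -(lquot_pi_repr x) lquot_piZ scale1r. Qed.

Lemma lquot_scalerDr : right_distributive lquot_scale +%R.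
Proof.
move=> c x y; rewrite -(lquot_pi_repr x) -(lquot_pi_repr y).
by rewrite -lquot_piD !lquot_piZ scalerDr lquot_piD.
Qed.

Lemma lquot_scalerDl x : {morph lquot_scale^~ x : a b / a + b}.
Proof.
by move=> a b; rewrite -(lquot_pi_repr x) !lquot_piZ scalerDl lquot_piD.
Qed.

HB.instance Definition _ := GRing.Zmodule_isLmodule.Build K lquot
  lquot_scalerA lquot_scale1r lquot_scalerDr lquot_scalerDl.

Fact lquot_pi_is_linear : linear lquot_pi.
Proof. by move=> c x y; rewrite lquot_piD -lquot_piZ. Qed.

HB.instance Definition _ := GRing.isLinear.Build K V lquot _ lquot_pi
  lquot_pi_is_linear.

End QuotientSpace.

(* The degree constraint i + 1 = j is an explicit (irrelevant) argument, so that
   no transport is needed along identities such as (i + l) + 1 = (i + 1) + l. *)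
Record cochain (K : fieldType) := Cochain {
  cobj :> int -> lmodType K;
  cdiff : forall i j : int, i + 1 = j -> {linear cobj i -> cobj j};
  cdiffK : forall i j k (e : i + 1 = j) (e' : j + 1 = k) x,
    cdiff e' (cdiff e x) = 0 }.

Arguments cdiff {K} A [i j] _ : rename.

Record chain_map (K : fieldType) (A B : cochain K) := ChainMap {
  chmap :> forall i, {linear A i -> B i};
  chmap_diff : forall i j (e : i + 1 = j) x,
    chmap j (cdiff A e x) = cdiff B e (chmap i x) }.

Section Complexes.
Variable K : fieldType.
Implicit Types A B : cochain K.

Lemma chain_map_ext A B (f g : chain_map A B) :
  (forall i x, f i x = g i x) -> f = g.
Proof.
case: f g => f pf [g pg] /= fg.
have e : f = g.
  by apply: functional_extensionality_dep => i; apply: linear_ext; exact: fg.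
by subst g; rewrite (Prop_irrelevance pf pg).
Qed.

Definition chain_id A : chain_map A A.
Proof.
refine (@ChainMap K A A (fun i => @lin_id K (A i)) _).
by move=> i j e x.
Defined.

Definition chain_comp A B (C : cochain K) (g : chain_map B C)
  (f : chain_map A B) : chain_map A C.
Proof.
refine (@ChainMap K A C (fun i => lin_comp (g i) (f i)) _).
by move=> i j e x /=; rewrite !chmap_diff.
Defined.

Definition Ch : category.
Proof.
refine (@Category (cochain K) (@chain_map K) chain_id chain_comp _ _ _).
- by move=> *; exact: chain_map_ext.
- by move=> *; exact: chain_map_ext.
- by move=> *; exact: chain_map_ext.
Defined.

Lemma csuspend_eq (l i j : int) : i + 1 = j -> i + l + 1 = j + l.
Proof. by move=> <-; rewrite addrAC. Qed.

(* (Sigma^l A)^i = A^(i + l).  No sign is put on the differential: only even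
   shifts are used below. *)
Definition csuspend (l : int) A : cochain K.
Proof.
refine (@Cochain K (fun i => A (i + l))
  (fun i j e => cdiff A (csuspend_eq l e)) _).
by move=> *; exact: cdiffK.
Defined.

End Complexes.

Section Cohomology.
Variable K : fieldType.
Implicit Types (A B : cochain K) (l : int).

Definition cocycle A l : {pred A l} :=
  [pred x | cdiff A (erefl (l + 1)) x == 0].

Fact cocycle_submod A l : submod_closed (@cocycle A l).
Proof.
split=> [|c x y]; rewrite !inE ?linear0 // => /eqP x0 /eqP y0.
by rewrite linearP x0 y0 scaler0 addr0.
Qed.

HB.instance Definition _ A l :=
  GRing.isSubmodClosed.Build K (A l) (@cocycle A l) (@cocycle_submod A l).

Record cocycles A l := Cocycle {
  cocycle_val :> A l;
  cocycle_valP : cocycle_val \in @cocycle A l }.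

HB.instance Definition _ A l := [isSub for @cocycle_val A l].
HB.instance Definition _ A l := [Choice of cocycles A l by <:].
HB.instance Definition _ A l := [SubChoice_isSubLmodule of cocycles A l by <:].

Definition coboundary A l : {pred cocycles A l} :=
  [pred z : cocycles A l |
    `[< exists (i : int) (e : i + 1 = l) (y : A i), cdiff A e y = val z >]].

Lemma coboundaryP A l (z : cocycles A l) :
  reflect (exists (i : int) (e : i + 1 = l) (y : A i), cdiff A e y = val z)
          (z \in @coboundary A l).
Proof. exact: asboolP. Qed.

Fact coboundary_submod A l : submod_closed (@coboundary A l).
Proof.
split=> [|c x y].
- apply/coboundaryP; exists (l - 1), (subrK 1 l), 0.
  by rewrite !linear0.
- move=> /coboundaryP[i [e [a xa]]] /coboundaryP[j [e' [b yb]]].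
  apply/coboundaryP; have ij : i = j by apply: (addIr 1); rewrite e e'.
  subst j; rewrite (eq_irrelevance e' e) in yb.
  by exists i, e, (c *: a + b); rewrite !linearP xa yb.
Qed.

HB.instance Definition _ A l := GRing.isSubmodClosed.Build K (cocycles A l)
  (@coboundary A l) (@coboundary_submod A l).

Definition cohom A l : lmodType K := lquot (@coboundary A l).

Definition cohom_class A l : {linear cocycles A l -> cohom A l} :=
  @lquot_pi K _ (@coboundary A l).

Lemma cohom_class_repr A l (a : cohom A l) : cohom_class A l (repr a) = a.
Proof. exact: lquot_pi_repr. Qed.

Lemma cohom_class_eq A l (z z' : cocycles A l) :
  cohom_class A l z = cohom_class A l z' <-> z - z' \in @coboundary A l.
Proof. exact: lquot_piE. Qed.

(* A linear map commuting with the differentials induces a map in cohomology.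
   The degrees of the source and target need not agree, so that this applies
   both to chain maps and to multiplication by powers of u. *)
Section Induced.
Variables (A B : cochain K) (i j : int) (f : {linear A i -> B j}).
Hypothesis f_cocycle : forall x, x \in @cocycle A i -> f x \in @cocycle B j.
Hypothesis f_coboundary : forall z z',
  z \in @coboundary A i -> val z' = f (val z) -> z' \in @coboundary B j.

Definition cocycles_map (z : cocycles A i) : cocycles B j :=
  Cocycle (f_cocycle (cocycle_valP z)).

Definition cohom_map_fun (a : cohom A i) : cohom B j :=
  cohom_class B j (cocycles_map (repr a)).

Lemma cohom_map_funE z :
  cohom_map_fun (cohom_class A i z) = cohom_class B j (cocycles_map z).
Proof.
apply/cohom_class_eq.
have /cohom_class_eq h := cohom_class_repr (cohom_class A i z).
by apply: f_coboundary h _; rewrite /= !linearB.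
Qed.

Fact cohom_map_is_linear : linear cohom_map_fun.
Proof.
move=> c a b.
rewrite -(cohom_class_repr a) -(cohom_class_repr b).
rewrite -linearP !cohom_map_funE -linearP; congr (cohom_class _ _ _).
by apply: val_inj; rewrite /= !linearP.
Qed.

HB.instance Definition _ :=
  GRing.isLinear.Build K _ _ _ cohom_map_fun cohom_map_is_linear.

Definition cohom_map : {linear cohom A i -> cohom B j} := cohom_map_fun.

End Induced.

Section ChainMap.
Variables (A B : cochain K) (f : chain_map A B) (l : int).

Lemma chain_map_cocycle x : x \in @cocycle A l -> f l x \in @cocycle B l.
Proof. by rewrite !inE -chmap_diff => /eqP ->; rewrite linear0. Qed.

Lemma chain_map_coboundary (z : cocycles A l) (z' : cocycles B l) :
  z \in @coboundary A l -> val z' = f l (val z) -> z' \in @coboundary B l.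
Proof.
move=> /coboundaryP[i [e [y yz]]] zz'; apply/coboundaryP.
by exists i, e, (f i y); rewrite -chmap_diff yz.
Qed.

Definition cohom_chain_map : {linear cohom A l -> cohom B l} :=
  cohom_map chain_map_cocycle chain_map_coboundary.

Lemma cohom_chain_mapE z :
  cohom_chain_map (cohom_class A l z)
  = cohom_class B l (cocycles_map chain_map_cocycle z).
Proof. exact: (@cohom_map_funE _ _ _ _ (f l) _ (@chain_map_coboundary)). Qed.

End ChainMap.

Definition quasi_iso A B (f : chain_map A B) : Prop :=
  forall l, bijective (cohom_chain_map f l).

End Cohomology.

Section HomotopyInterleavings.
Variables (R : realType) (K : fieldType).
Implicit Types X Y : rfun R (Ch K).

Definition weq X Y (f : nat_trans X Y) : Prop := forall r, quasi_iso (f r).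

Definition zigzag_weq X Y : Prop :=
  clos_refl_sym_trans _ (fun X Y => exists f : nat_trans X Y, weq f) X Y.

Definition homotopy_interleaved (e : R) X Y : Prop :=
  exists X' Y',
    [/\ zigzag_weq X X', zigzag_weq Y Y' & interleaved e X' Y'].

End HomotopyInterleavings.

Record dgmod (K : fieldType) := DGMod {
  dgcpx :> cochain K;
  dgu : forall i j : int, i + 2 = j -> {linear dgcpx i -> dgcpx j};
  dgu_diff : forall i j k l (e1 : i + 1 = j) (e2 : j + 2 = k)
      (e3 : i + 2 = l) (e4 : l + 1 = k) x,
    dgu e2 (cdiff dgcpx e1 x) = cdiff dgcpx e4 (dgu e3 x) }.

Arguments dgu {K} M [i j] _ : rename.

Section DGModules.
Variable K : fieldType.
Implicit Types M N : dgmod K.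

Definition lin_cast M (i j : int) (e : i = j) : {linear M i -> M j} :=
  match e in _ = j return {linear M i -> M j} with
  | erefl => @lin_id K (M i)
  end.

Lemma upow_eq0 (i j : int) : i + 2 * 0%N%:Z = j -> i = j.
Proof. by rewrite mulr0 addr0. Qed.

Lemma upow_eqS (n : nat) (i j : int) :
  i + 2 * n.+1%:Z = j -> i + 2 * n%:Z + 2 = j.
Proof. by move=> <-; lia. Qed.

Fixpoint upow M (n : nat) (i j : int) :
    i + 2 * n%:Z = j -> {linear M i -> M j} :=
  match n return i + 2 * n%:Z = j -> {linear M i -> M j} with
  | 0%N => fun e => lin_cast M (upow_eq0 e)
  | m.+1 => fun e =>
      lin_comp (dgu M (upow_eqS e)) (upow M (erefl (i + 2 * m%:Z)))
  end.

Lemma upow0 M (i : int) (e : i + 2 * 0%N%:Z = i) x : upow M e x = x.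
Proof. by rewrite /= (eq_irrelevance (upow_eq0 e) erefl). Qed.

Lemma upowS M n (i j k : int) (e : i + 2 * n.+1%:Z = k)
    (e1 : i + 2 * n%:Z = j) (e2 : j + 2 = k) x :
  upow M e x = dgu M e2 (upow M e1 x).
Proof. by subst j; rewrite /= (eq_irrelevance (upow_eqS e) e2). Qed.

Lemma upowD M m n p (i j k : int) (e1 : i + 2 * m%:Z = j)
    (e2 : j + 2 * n%:Z = k) (e3 : i + 2 * p%:Z = k) x :
  upow M e2 (upow M e1 x) = upow M e3 x.
Proof.
have pE : p = (n + m)%N by lia.
subst p.
elim: n k e2 e3 => [|n IHn] k e2 e3.
  have jk : j = k by lia.
  by case: k / jk e2 e3 => e2 e3; rewrite upow0 (eq_irrelevance e3 e1).
have e4 : i + 2 * (n + m)%N%:Z = j + 2 * n%:Z by lia.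
have e5 : j + 2 * n%:Z + 2 = k by lia.
by rewrite (upowS e2 erefl e5) (upowS e3 e4 e5) (IHn _ erefl e4).
Qed.

Lemma upow_diff M n (i j k l : int) (e1 : i + 1 = j) (e2 : j + 2 * n%:Z = k)
    (e3 : i + 2 * n%:Z = l) (e4 : l + 1 = k) x :
  upow M e2 (cdiff M e1 x) = cdiff M e4 (upow M e3 x).
Proof.
elim: n k l e2 e3 e4 => [|n IHn] k l e2 e3 e4.
  have jk : j = k by lia.
  have il : i = l by lia.
  case: k / jk e2 e4 => e2 e4; case: l / il e3 e4 => e3 e4.
  by rewrite !upow0 (eq_irrelevance e1 e4).
have e5 : i + 2 * n%:Z + 1 = j + 2 * n%:Z by lia.
have e6 : j + 2 * n%:Z + 2 = k by lia.
have e7 : i + 2 * n%:Z + 2 = l by lia.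
rewrite (upowS e2 erefl e6) (upowS e3 erefl e7) (IHn _ _ erefl erefl e5).
exact: dgu_diff.
Qed.

Section CohomologyAction.
Variables (M : dgmod K) (n : nat) (i j : int) (e : i + 2 * n%:Z = j).

Lemma upow_cocycle x : x \in @cocycle K M i -> upow M e x \in @cocycle K M j.
Proof.
have e' : i + 1 + 2 * n%:Z = j + 1 by lia.
by rewrite !inE -(upow_diff erefl e') => /eqP ->; rewrite linear0.
Qed.

Lemma upow_coboundary (z : cocycles M i) (z' : cocycles M j) :
  z \in @coboundary K M i -> val z' = upow M e (val z) ->
  z' \in @coboundary K M j.
Proof.
move=> /coboundaryP[k [ek [y yz]]] zz'; apply/coboundaryP.
have e4 : k + 2 * n%:Z + 1 = j by lia.
exists (k + 2 * n%:Z), e4, (upow M (erefl _) y).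
by rewrite -(upow_diff ek e) yz.
Qed.

Definition cohom_upow : {linear cohom M i -> cohom M j} :=
  cohom_map upow_cocycle upow_coboundary.

Lemma cohom_upowE z :
  cohom_upow (cohom_class M i z)
  = cohom_class M j (cocycles_map upow_cocycle z).
Proof.
exact: (@cohom_map_funE K M M i j _ upow_cocycle upow_coboundary z).
Qed.

End CohomologyAction.

(* The elements of H(M), the direct sum of the H^l(M), are the finitely
   supported families. *)
Definition finsupp M (x : forall l, cohom M l) : Prop :=
  exists s : seq int, forall l, l \notin s -> x l = 0.

(* (p . x)_l = sum_k p_k u^k x_(l - 2k) *)
Definition polyact M (p : {poly K}) (x : forall l, cohom M l) (l : int) :
    cohom M l :=
  \sum_(k < size p)
    p`_k *: cohom_upow M (subrK (2 * (val k)%:Z) l) (x (l - 2 * (val k)%:Z)).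

Definition cohom_fg M : Prop :=
  exists (n : nat) (g : 'I_n -> forall l, cohom M l),
    (forall j, finsupp (g j)) /\
    forall y : forall l, cohom M l, finsupp y ->
      exists p : 'I_n -> {poly K},
        forall l, y l = \sum_(j < n) polyact (p j) (g j) l.

Variable R : realType.

Lemma floor_upow_eq (i : int) (r s : R) : r <= s ->
  i + 2 * Num.floor r + 2 * `|Num.floor s - Num.floor r|%N%:Z
  = i + 2 * Num.floor s.
Proof. by move=> /le_floor h; lia. Qed.

Definition alpha_map M (r s : R) (h : r <= s) :
  chain_map (csuspend (2 * Num.floor r) M) (csuspend (2 * Num.floor s) M).
Proof.
refine (@ChainMap K (csuspend (2 * Num.floor r) M)
  (csuspend (2 * Num.floor s) M) (fun i => upow M (floor_upow_eq i h)) _).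
by move=> i j e x; exact: upow_diff.
Defined.

Definition alpha M : rfun R (Ch K).
Proof.
refine (@RFun R (Ch K) (fun r => csuspend (2 * Num.floor r) M)
  (@alpha_map M) _ _).
- move=> r h; apply: chain_map_ext => i x /=; move: (floor_upow_eq i h).
  by rewrite subrr absz0 => e; exact: upow0.
- move=> r s t h1 h2 h3; apply: chain_map_ext => i x /=; exact: upowD.
Defined.

Definition nu (k : int) M : rfun R (Vect K).
Proof.
refine (@RFun R (Vect K) (fun r => cohom M (k + 2 * Num.floor r))
  (fun r s h => cohom_upow M (floor_upow_eq k h)) _ _).
- move=> r h; apply: linear_ext => a; rewrite -(cohom_class_repr a).
  move: (floor_upow_eq k h); rewrite subrr absz0 => e.
  rewrite (cohom_upowE e); congr (cohom_class _ _ _).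
  by apply: val_inj; exact: upow0.
- move=> r s t h1 h2 h3; apply: linear_ext => a; rewrite -(cohom_class_repr a).
  rewrite [LHS]/= (cohom_upowE (floor_upow_eq k h1)) !cohom_upowE.
  congr (cohom_class _ _ _).
  by apply: val_inj; exact: upowD.
Defined.

Definition dCohI M N : \bar R :=
  Order.max (dI (nu 0 M) (nu 0 N)) (dI (nu 1 M) (nu 1 N)).

End DGModules.

Arguments alpha {K} R M.
Arguments nu {K R} k M.
Arguments dCohI {K} R M N.

(* Main.v *)
(* A natural transformation between functors on (R, <=) that only depend on
   integer parts is determined by its components at the integers, so whether
   two such functors are e-interleaved depends only on floor e and floor (2e).
   These are right-continuous in e, hence the infimum defining d_I is attained
   for the nu^k.

   Every dg K[u]-module M is formal.  Choose a linear p : M -> H(M) extending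
   z |-> [z] on cocycles and vanishing on boundaries; then p u - u p = h d for
   some linear h.  In the tower T with
     T^l = prod_n H^(l + 2n) x prod_n H^(l + 2n + 1),
     d (a, b) = (0, (a_(n+1) - u a_n)_n),
   where u shifts both sequences, M -> T, m |-> (p (u^n m), h (u^n m)) and
   H(M) -> T, x |-> (u^n x, 0) are quasi-isomorphisms of dg K[u]-modules.

   As H(M) has zero differential, eps-interleavings of the nu^k assemble
   degreewise to one of alpha H(M) and alpha H(N).  Conversely, taking
   cohomology turns zigzags of weak equivalences into natural isomorphisms, so
   homotopy interleavings bound d_I of the nu^k. *)
Require Import Defs.
From HB Require Import structures.
From mathcomp Require Import all_boot all_order all_algebra.
From mathcomp Require Import boolp classical_sets.
From mathcomp Require Import reals constructive_ereal ereal.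
From Stdlib Require Import Relation_Operators.
From mathcomp Require Import lra zify.

Set Implicit Arguments.
Unset Strict Implicit.
Unset Printing Implicit Defensive.

Import Order.TTheory GRing.Theory Num.Theory.
(* [Defs.rshift] would otherwise be shadowed by [fintype.rshift]. *)
Import Defs.

Local Open Scope ring_scope.

(** * Interleavings *)


Section Interleavings.
Variables (R : realType) (C : category).
Implicit Types (F G H : rfun R C) (e : R).

Lemma nat_trans_ext F G (a b : nat_trans F G) : (forall r, a r = b r) -> a = b.
Proof.
case: a b => a an [b bn] /= ab.
have {}ab : a = b by apply: functional_extensionality_dep.
by subst b; rewrite (Prop_irrelevance an bn).
Qed.

(** Componentwise form of an interleaving, quantified over every proof of the inequality, so that
    later rewriting does not depend on the proof chosen in [rstruct]. *)
Lemma interleavedP e F G : interleaved e F G <->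
  0 <= e /\ exists (phi : nat_trans F (rshift e G))
                   (psi : nat_trans G (rshift e F)),
    (forall (r : R) (h : r <= r + e + e),
       compm (psi (r + e)) (phi r) = rmap F h) /\
    (forall (r : R) (h : r <= r + e + e),
       compm (phi (r + e)) (psi r) = rmap G h).
Proof.
split=> [[e0 [phi [psi [p q]]]]|[e0 [phi [psi [p q]]]]].
  split=> //; exists phi, psi; split=> r h.
    have /= -> := congr1 (fun t : nat_trans _ _ => t r) p.
    by congr (rmap F _); exact: bool_irrelevance.
  have /= -> := congr1 (fun t : nat_trans _ _ => t r) q.
  by congr (rmap G _); exact: bool_irrelevance.
exists e0, phi, psi; split; apply: nat_trans_ext => r /=; [exact: p|exact: q].
Qed.

Definition nat_iso F G := exists (a : nat_trans F G) (b : nat_trans G F),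
  (forall r, compm (b r) (a r) = idm (F r)) /\
  (forall r, compm (a r) (b r) = idm (G r)).

Lemma nat_iso_refl F : nat_iso F F.
Proof.
have n r s (h : r <= s) : compm (idm (F s)) (rmap F h)
    = compm (rmap F h) (idm (F r)) by rewrite comp_idl comp_idr.
by exists (NatTrans n), (NatTrans n); split=> r /=; rewrite comp_idl.
Qed.

Lemma nat_iso_sym F G : nat_iso F G -> nat_iso G F.
Proof. by move=> [a [b [ba ab]]]; exists b, a. Qed.

Lemma nat_iso_trans F G H : nat_iso F G -> nat_iso G H -> nat_iso F H.
Proof.
move=> [a [b [ba ab]]] [c [d [dc cd]]].
exists (nt_comp c a), (nt_comp b d); split=> r /=.
  by rewrite -compA (compA (d r)) dc comp_idl.
by rewrite -compA (compA (a r)) ab comp_idl.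
Qed.

Lemma interleaved_iso e F F' G G' : nat_iso F F' -> nat_iso G G' ->
  interleaved e F G -> interleaved e F' G'.
Proof.
move=> [a [b [ba ab]]] [c [d [dc cd]]] /interleavedP[e0 [phi [psi [p q]]]].
apply/interleavedP; split=> //.
exists (nt_comp (nt_shift e c) (nt_comp phi b)).
exists (nt_comp (nt_shift e a) (nt_comp psi d)); split=> r h /=.
  rewrite -!compA (compA (d _)) dc comp_idl (compA (psi _)) (p _ h).
  by rewrite compA nt_nat -compA ab comp_idr.
rewrite -!compA (compA (b _)) ba comp_idl (compA (phi _)) (q _ h).
by rewrite compA nt_nat -compA cd comp_idr.
Qed.

(** Composing with the structure maps from [r + e] to [r + e'] enlarges the shift; naturality then
    merges the two corrections into one structure map. *)
Lemma interleaved_le e e' F G : e <= e' ->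
  interleaved e F G -> interleaved e' F G.
Proof.
move=> ee /interleavedP[e0 [phi [psi [p q]]]].
apply/interleavedP; split; first exact: le_trans ee.
have le1 (r : R) : r + e <= r + e' by rewrite lerD2l.
have up F' G' (f : nat_trans F' (rshift e G')) :
    exists g : nat_trans F' (rshift e' G'),
      forall r, g r = compm (rmap G' (le1 r)) (f r).
  unshelve eexists; first
    refine (@NatTrans _ _ F' (rshift e' G')
      (fun r => compm (rmap G' (le1 r)) (f r)) _); last by [].
  move=> r s h /=; rewrite -compA (nt_nat f) /= !compA; congr compm.
  have h' : r + e <= s + e' by rewrite lerD.
  by rewrite !(rmap_comp _ _ _ h').
have [phi' phiE] := up _ _ phi; have [psi' psiE] := up _ _ psi.
exists phi', psi'.
have le2 (r : R) : r <= r + e + e by rewrite -addrA lerDl addr_ge0.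
have le3 (r : R) : r + e + e <= r + e' + e by rewrite !lerD.
have le4 (r : R) : r + e + e <= r + e' + e' by rewrite !lerD.
split=> r h; rewrite phiE psiE.
  rewrite -!compA (compA (psi _)) (nt_nat psi) /= -!compA (p _ (le2 r)).
  by rewrite (rmap_comp _ _ _ (le_trans (le2 r) (le3 r))) (rmap_comp _ _ _ h).
rewrite -!compA (compA (phi _)) (nt_nat phi) /= -!compA (q _ (le2 r)).
by rewrite (rmap_comp _ _ _ (le_trans (le2 r) (le3 r))) (rmap_comp _ _ _ h).
Qed.

Lemma interleaved_shift c e F G : interleaved e F G ->
  interleaved e (rshift c F) (rshift c G).
Proof.
move=> /interleavedP[e0 [phi [psi [p q]]]]; apply/interleavedP; split=> //.
(* The two sides are equal but not convertible, so the components are corrected by the structure map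
   along this inequality. *)
have le1 (r : R) : r + c + e <= r + e + c by rewrite addrAC.
have sh F' G' (f : nat_trans F' (rshift e G')) :
    exists g : nat_trans (rshift c F') (rshift e (rshift c G')),
      forall r, g r = compm (rmap G' (le1 r)) (f (r + c)).
  unshelve eexists; first
    refine (@NatTrans _ _ (rshift c F') (rshift e (rshift c G'))
      (fun r => compm (rmap G' (le1 r)) (f (r + c))) _); last by [].
  move=> r s h /=; rewrite -compA (nt_nat f) /= !compA; congr compm.
  have h' : r + c + e <= s + e + c by rewrite addrAC !lerD.
  by rewrite !(rmap_comp _ _ _ h').
have [phi' phiE] := sh _ _ phi; have [psi' psiE] := sh _ _ psi.
exists phi', psi'.
have le2 (r : R) : r <= r + e + e by rewrite -addrA lerDl addr_ge0.
have le3 (r : R) : r + c + e + e <= r + e + c + e by rewrite lerD.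
split=> r h; rewrite phiE psiE.
  rewrite -!compA (compA (psi _)) (nt_nat psi) /= -!compA (p _ (le2 _)).
  rewrite (rmap_comp _ _ _ (le_trans (le2 _) (le3 r))).
  by rewrite (rmap_comp _ _ _ (rshift_le c h)).
rewrite -!compA (compA (phi _)) (nt_nat phi) /= -!compA (q _ (le2 _)).
rewrite (rmap_comp _ _ _ (le_trans (le2 _) (le3 r))).
by rewrite (rmap_comp _ _ _ (rshift_le c h)).
Qed.

End Interleavings.

(** * Functors that depend only on integer parts, and the infimum in the interleaving distance *)

Section FloorFunctors.
Variables (R : realType) (C : category).

(** A functor that factors through the floor. [fmap] also leads from [r] to a smaller [s] with the
    same floor, so points can be moved both ways within a unit interval. *)
Record floor_rfun := FloorRFun {
  frfun :> rfun R C;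
  fmap : forall r s : R, Num.floor r <= Num.floor s -> hom (frfun r) (frfun s);
  fmapE : forall r s (h : Num.floor r <= Num.floor s) (h' : r <= s),
    fmap h = rmap frfun h';
  fmap_comp : forall r s t (h1 : Num.floor r <= Num.floor s)
      (h2 : Num.floor s <= Num.floor t) (h3 : Num.floor r <= Num.floor t),
    compm (fmap h2) (fmap h1) = fmap h3 }.

Arguments fmap F [r s] _ : rename.
Arguments fmapE F [r s] _ _ : rename.
Arguments fmap_comp F [r s t] _ _ _ : rename.

Implicit Types (F G : floor_rfun) (e : R).

Local Notation fl r := ((Num.floor r)%:~R : R).

Lemma floor_fl (r : R) : Num.floor (fl r) = Num.floor r.
Proof. exact: intrKfloor. Qed.

Lemma floor_flD (r s : R) : Num.floor (fl r + s) = Num.floor r + Num.floor s.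
Proof. by rewrite floorDzr ?intrKfloor ?intr_int. Qed.

Lemma fmapC F r s t u (h1 : Num.floor r <= Num.floor s)
    (h2 : Num.floor s <= Num.floor u) (h3 : Num.floor r <= Num.floor t)
    (h4 : Num.floor t <= Num.floor u) :
  compm (fmap F h2) (fmap F h1) = compm (fmap F h4) (fmap F h3).
Proof. by rewrite !(fmap_comp _ _ _ (le_trans h1 h2)). Qed.

Section Snap.
Variables (e e' : R) (e0 : 0 <= e) (ee : e <= e').
Hypotheses (e1 : Num.floor e = Num.floor e').
Hypothesis (e2 : Num.floor (e + e) = Num.floor (e' + e')).

Lemma snap_le1 (r : R) : Num.floor r <= Num.floor (fl r).
Proof. by rewrite floor_fl. Qed.

Lemma snap_le2 (r : R) : Num.floor (fl r + e') <= Num.floor (r + e).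
Proof. by rewrite floor_flD -e1 -floor_flD le_floor ?lerD2r ?floor_le. Qed.

Section Def.
Variables (F G : floor_rfun) (f : nat_trans F (rshift e' G)).

(** Round [r] down to an integer, apply [f] there, and move on to [r + e]. The last move exists
    because [e] and [e'] have the same floor and [fl r] is an integer. *)
Definition snap_fun (r : R) : hom (F r) (G (r + e)) :=
  compm (fmap G (snap_le2 r)) (compm (f (fl r)) (fmap F (snap_le1 r))).

Lemma snap_nat r s (h : r <= s) : compm (snap_fun s) (rmap F h)
  = compm (rmap (rshift e G) h) (snap_fun r).
Proof.
have h1 := le_floor h.
have h2 : fl r <= fl s by rewrite ler_int.
have h3 := rshift_le e h.
have h4 := le_floor h2; have h5 := le_floor h3.
have h6 := le_floor (rshift_le e' h2).
rewrite /snap_fun -!compA -(fmapE _ h1 h) (fmapC _ _ _ (snap_le1 r) h4).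
rewrite (fmapE _ _ h2) (compA (f _)) nt_nat /=.
rewrite -(fmapE _ h5 (rshift_le e h)) -(fmapE _ h6 (rshift_le e' h2)) !compA.
by rewrite (fmapC _ _ _ (snap_le2 r) h5).
Qed.

Definition snap : nat_trans F (rshift e G) :=
  @NatTrans R C F (rshift e G) snap_fun snap_nat.

End Def.

(** Both roundings can be undone: [g] is brought back by naturality from [fl (r + e)] to [n + e'],
    where [gf] applies at [n]. Equality of the floors of [e + e] and [e' + e'] is what lets the
    result continue to [r + e + e]. *)
Lemma snap_comp F G (f : nat_trans F (rshift e' G))
    (g : nat_trans G (rshift e' F)) :
  (forall (r : R) (h : r <= r + e' + e'),
     compm (g (r + e')) (f r) = rmap F h) ->
  forall (r : R) (h : r <= r + e + e),
    compm (snap g (r + e)) (snap f r) = rmap F h.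
Proof.
move=> gf r h.
(* The integer [s] is the floor of [n + e'] and lies below both [n + e'] and [fl (r + e)], so it
   links the two points at which [g] is needed. *)
pose n := fl r; pose a : R := fl e; pose s := n + a.
have e0' : 0 <= e' by exact: le_trans ee.
have sE : s = fl (n + e') by rewrite floor_flD -e1 /s -rmorphD.
have hs : Num.floor (n + e') <= Num.floor s by rewrite sE floor_fl.
have s_e' : s <= n + e' by rewrite sE floor_le.
have s_re : s <= fl (r + e).
  by rewrite /s /n -rmorphD ler_int -floor_flD le_floor ?lerD2r ?floor_le.
have k1 := le_floor s_e'; have k2 := le_floor s_re.
(* Since [s] and [n + e'] have the same floor, [g] at [s] determines [g] at [n + e']. *)
have X : compm (fmap F (le_floor (rshift_le e' s_e')))
    (compm (g s) (fmap G hs)) = g (n + e').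
  rewrite compA (fmapE _ _ (rshift_le e' s_e')) -(nt_nat g s_e') -compA.
  rewrite -(fmapE _ k1 s_e') (fmap_comp _ _ _ (lexx _)) (fmapE _ _ (lexx _)).
  by rewrite rmap_id comp_idr.
have h1 : Num.floor (n + e' + e') <= Num.floor (r + e + e).
  rewrite -addrA floor_flD -e2 -floor_flD -addrA.
  by rewrite le_floor // lerD2r floor_le.
have h2 : n <= n + e' + e' by rewrite -addrA lerDl addr_ge0.
rewrite /= /snap_fun -!compA (compA (fmap G _) (fmap G _)).
have h3 : Num.floor (n + e') <= Num.floor (fl (r + e)) by exact: le_trans k2.
rewrite (fmap_comp _ _ _ h3) -(fmap_comp _ hs k2 h3) (fmapE _ k2 s_re).
rewrite -!compA (compA (g _)) (nt_nat g s_re) /=.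
rewrite -(fmapE _ (le_floor (rshift_le e' s_re)) (rshift_le e' s_re)) -!compA.
rewrite (compA (fmap F _) (fmap F _)).
rewrite (fmapC _ _ _ (le_floor (rshift_le e' s_e')) h1) -!compA.
rewrite (compA (g s)) (compA (fmap F _) (compm (g s) _)) X.
rewrite (compA (g _)) (gf _ h2) -(fmapE _ (le_floor h2) h2).
rewrite !(fmap_comp _ _ _ (le_trans (snap_le1 r) (le_floor h2))).
by rewrite (fmap_comp _ _ _ (le_floor h)) (fmapE _ _ h).
Qed.

End Snap.

Lemma interleaved_snap e e' F G : 0 <= e -> e <= e' ->
  Num.floor e = Num.floor e' -> Num.floor (e + e) = Num.floor (e' + e') ->
  interleaved e' F G -> interleaved e F G.
Proof.
move=> e0 ee e1 e2 /interleavedP[_ [f [g [gf fg]]]]; apply/interleavedP.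
by split=> //; exists (snap e1 f), (snap e1 g); split; apply: snap_comp.
Qed.

Lemma dI_attained e F G : 0 <= e -> (dI F G <= e%:E)%E -> interleaved e F G.
Proof.
move=> e0 dFG.
(* The first point after [e] at which the floor of x or of x + x jumps: on the interval from [e] up
   to but excluding [b] both floors are constant. *)
pose b : R := Num.min (Num.floor e + 1)%:~R ((Num.floor (e + e) + 1)%:~R / 2).
have eb : e < b.
  rewrite lt_min floorD1_gt /=.
  have := floorD1_gt (e + e); lra.
have : (dI F G < b%:E)%E by rewrite (le_lt_trans dFG) ?lte_fin.
rewrite /dI => /ereal_inf_lt[_ [e' FG <-]]; rewrite lte_fin => e'b.
have [e'e|/ltW ee'] := leP e' e; first exact: interleaved_le FG.
apply: (interleaved_snap e0 ee' _ _ FG); apply/eqP.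
  rewrite eq_le le_floor //= -ltzD1 floor_lt_int.
  by apply: lt_le_trans e'b _; rewrite ge_min lexx.
rewrite eq_le le_floor ?lerD //= -ltzD1 floor_lt_int.
have : e' < ((Num.floor (e + e) + 1)%:~R) / 2 :> R.
  by apply: lt_le_trans e'b _; rewrite ge_min lexx orbT.
lra.
Qed.

End FloorFunctors.

Lemma dI_ge0 (R : realType) (C : category) (F G : rfun R C) : (0 <= dI F G)%E.
Proof.
by apply/ereal_infP => _ [e /interleavedP[e0 _] <-]; rewrite lee_fin.
Qed.

Lemma dI_le (R : realType) (C : category) (F G : rfun R C) e :
  interleaved e F G -> (dI F G <= e%:E)%E.
Proof. by move=> FG; apply: ereal_inf_lbound; exists e. Qed.

(** * Factorization of linear maps *)


Section LinearFactorization.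
Variables (K : fieldType) (V W U : lmodType K).
Variables (f : {linear V -> W}) (g : {linear V -> U}).

(** Graphs of partial linear maps extending f v |-> g v. By linearity, being single-valued need only
    be required over 0. *)
Let graph (A : set (W * U)) : Prop :=
  [/\ forall v, A (f v, g v), forall c x y, A x -> A y -> A (c *: x + y)
    & forall u, A (0, u) -> u = 0].

Let graph_maximal : (forall v, f v = 0 -> g v = 0) ->
  exists A, graph A /\ forall B, (A `<` B)%classic -> ~ graph B.
Proof.
move=> fg; pose P A := A = set0 \/ graph A.
have gr0 : graph [set (f v, g v) | v in setT]%classic.
  split=> [v|c _ _ [v _ <-] [w _ <-]|u [v _ [/fg -> <-]] //]; first by exists v.
  by exists (c *: v + w) => //; rewrite !linearP.
have gr_at A x : P A -> A x -> graph A by case=> [->|].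
have [F FP Ftot|A [PA Amax]] := @Zorn_bigcup _ P; last first.
  exists A; split=> [|B AB gB]; last by apply: (Amax B AB); right.
  case: PA => // A0; exfalso; apply: Amax; last by right; exact: gr0.
  by rewrite A0; split=> // /(_ (f 0, g 0)); apply; exists 0.
have [[x [A FA Ax]]|nF] := pselect (exists x, (\bigcup_(X in F) X)%classic x);
  last by left; apply/seteqP; split=> // x ?; apply: nF; exists x.
have [grA1 grA2 grA3] := gr_at A x (FP A FA) Ax.
right; split=> [v|c y z [B FB By] [C FC Cz]|u [B FB Bu]].
- by exists A.
- have [BC|CB] := Ftot B C FB FC.
    exists C => //; have [_ lin _] := gr_at C z (FP C FC) Cz.
    by apply: lin => //; exact: BC.
  exists B => //; have [_ lin _] := gr_at B y (FP B FB) By.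
  by apply: lin => //; exact: CB.
- by have [_ _] := gr_at B _ (FP B FB) Bu; apply.
Qed.

(** The map is forced on the image of [f] and has to be extended to [W]; a maximal graph has full
    domain, so it is the graph of such an extension. *)
Lemma linear_factor : (forall v, f v = 0 -> g v = 0) ->
  exists h : {linear W -> U}, forall v, h (f v) = g v.
Proof.
move=> /graph_maximal[A [[grA linA funA] Amax]].
have A0 : A 0 by have := grA 0; rewrite !linear0.
have scA c x : A x -> A (c *: x).
  by move=> Ax; rewrite -[_ *: _]addr0; exact: linA.
have tot w : exists u, A (w, u).
  apply: contrapT => nw.
  (* If [w] is outside the domain of [A], then [B] extends [A] by sending [w] to 0. *)
  pose B := [set p : W * U | exists c, A (p.1 - c *: w, p.2)]%classic.
  apply: (Amax B).
    split=> [p Ap|BA].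
      by exists 0; rewrite scale0r subr0 -surjective_pairing.
    by apply: nw; exists 0; apply: BA; exists 1; rewrite /= scale1r subrr.
  split=> [v|c [x1 x2] [y1 y2] [a /= Ax] [b /= Ay]|u [c /= Au]].
  - by exists 0; rewrite /= scale0r subr0.
  - exists (c * a + b); have := linA c _ _ Ax Ay; rewrite /=.
    set p := (X in A X) => Ap; set q := (X in A X).
    suff -> : q = p by [].
    by rewrite /p /q scalerDl opprD addrACA -scalerA -scalerBr.
  (* For nonzero [c], rescaling the pair (- c w, u) of [A] would put [w] in the domain. *)
  - have [c0|c0] := eqVneq c 0.
      by rewrite c0 scale0r subr0 in Au; exact: funA.
    case: nw; exists (- c^-1 *: u); have := scA (- c^-1) _ Au.
    set p := (X in A X) => Ap; set q := (X in A X).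
    suff -> : q = p by [].
    apply: injective_projections => //=.
    by rewrite sub0r scalerN scaleNr opprK scalerK.
have [h hA] := choice tot.
have uniqA w u u' : A (w, u) -> A (w, u') -> u = u'.
  move=> Au Au'; apply/eqP; rewrite -subr_eq0; apply/eqP/funA.
  have := linA (-1) _ _ Au' Au; set p := (X in A X) => Ap; set q := (X in A X).
  suff -> : q = p by [].
  by apply: injective_projections; rewrite /= scaleN1r ?addNr // addrC.
have h_lin : linear h.
  by move=> c x y; apply: uniqA (hA _) (linA c _ _ (hA x) (hA y)).
pose H := GRing.isLinear.Build K W U _ h h_lin.
pose h' : {linear W -> U} := HB.pack h H.
by exists h' => v; apply: uniqA (hA _) (grA v).
Qed.

End LinearFactorization.

Lemma bij_linear_inv (K : fieldType) (V W : lmodType K) (f : {linear V -> W}) :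
  bijective f -> exists2 g : {linear W -> V}, cancel f g & cancel g f.
Proof.
move=> [g fg gf].
have g_lin : linear g.
  by move=> c x y; rewrite -[LHS]fg gf -{1}(gf x) -{1}(gf y) -linearP.
pose H := GRing.isLinear.Build K W V _ g g_lin.
pose g' : {linear W -> V} := HB.pack g H.
by exists g'.
Qed.

(** * Cohomology as a functor *)


Section CohomologyFunctor.
Variables (R : realType) (K : fieldType).
Implicit Types (A B : cochain K) (X Y : rfun R (Ch K)) (l : int).

Lemma cohom_ind A l (P : cohom A l -> Prop) :
  (forall z, P (cohom_class A l z)) -> forall a, P a.
Proof. by move=> Pz a; rewrite -(cohom_class_repr a). Qed.

Lemma cohom_chain_map_id A l : cohom_chain_map (chain_id A) l =1 id.
Proof.
apply: cohom_ind => z; rewrite cohom_chain_mapE; congr (cohom_class _ _ _).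
exact: val_inj.
Qed.

Lemma cohom_chain_map_comp A B (C : cochain K) (g : chain_map B C)
    (f : chain_map A B) l a :
  cohom_chain_map (chain_comp g f) l a
  = cohom_chain_map g l (cohom_chain_map f l a).
Proof.
move: a; apply: cohom_ind => z; rewrite !cohom_chain_mapE.
by congr (cohom_class _ _ _); exact: val_inj.
Qed.

Definition cohom_rfun l X : rfun R (Vect K).
Proof.
refine (@RFun R (Vect K) (fun r => cohom (X r) l)
  (fun r s h => cohom_chain_map (rmap X h) l) _ _).
- move=> r h; apply: linear_ext => a; rewrite rmap_id.
  exact: cohom_chain_map_id.
- move=> r s t h1 h2 h3; apply: linear_ext => a.
  by rewrite -(rmap_comp X h1 h2 h3) [RHS]cohom_chain_map_comp.
Defined.

Definition cohom_nat l X Y (f : nat_trans X Y) :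
  nat_trans (cohom_rfun l X) (cohom_rfun l Y).
Proof.
refine (@NatTrans R (Vect K) (cohom_rfun l X) (cohom_rfun l Y)
  (fun r => cohom_chain_map (f r) l) _).
move=> r s h; apply: linear_ext => a /=.
rewrite -!cohom_chain_map_comp; congr (cohom_chain_map _ _ _).
exact: (nt_nat f h).
Defined.

Lemma cohom_interleaved l e X Y :
  interleaved e X Y -> interleaved e (cohom_rfun l X) (cohom_rfun l Y).
Proof.
move=> /interleavedP[e0 [phi [psi [p q]]]]; apply/interleavedP; split=> //.
exists (cohom_nat l phi), (cohom_nat l psi).
split=> r h; apply: linear_ext => a /=.
  by rewrite -cohom_chain_map_comp -(p r h).
by rewrite -cohom_chain_map_comp -(q r h).
Qed.

(** Pointwise inverses are linear, and naturality of [f] gives theirs after cancelling the injective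
    [f s]. *)
Lemma nat_iso_bij (F G : rfun R (Vect K)) (f : nat_trans F G) :
  (forall r, bijective (f r)) -> nat_iso F G.
Proof.
move=> bf.
have ex r : exists g : {linear G r -> F r}, cancel (f r) g /\ cancel g (f r).
  by have [g] := bij_linear_inv (bf r); exists g.
pose g r := sval (cid (ex r)); have gP r := svalP (cid (ex r)).
have gn r s (h : r <= s) : compm (g s : hom (G s) (F s)) (rmap G h)
    = compm (rmap F h) (g r : hom (G r) (F r)).
  apply: linear_ext => a /=; apply: (can_inj (gP s).1); rewrite (gP s).2.
  have := congr1 (fun t : {linear _ -> _} => t (g r a)) (nt_nat f h).
  by rewrite /= (gP r).2 => ->.
exists f, (@NatTrans R (Vect K) G F g gn).
by split=> r; apply: linear_ext => a; [exact: (gP r).1|exact: (gP r).2].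
Qed.

Lemma zigzag_nat_iso l X Y : zigzag_weq X Y ->
  nat_iso (cohom_rfun l X) (cohom_rfun l Y).
Proof.
elim=> [{}X {}Y [f wf]|{}X|{}X {}Y _|{}X {}Y Z _ XY _].
- by apply: (nat_iso_bij (f := cohom_nat l f)) => r; exact: wf.
- exact: nat_iso_refl.
- exact: nat_iso_sym.
- exact: nat_iso_trans XY.
Qed.

Lemma homotopy_interleaved_cohom l e X Y : homotopy_interleaved e X Y ->
  interleaved e (cohom_rfun l X) (cohom_rfun l Y).
Proof.
move=> [X' [Y' [XX YY XY]]].
by apply: interleaved_iso (cohom_interleaved l XY);
  apply: nat_iso_sym; exact: zigzag_nat_iso.
Qed.

Lemma cdiff_irr A (i j : int) (e e' : i + 1 = j) x : cdiff A e x = cdiff A e' x.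
Proof. by rewrite (eq_irrelevance e e'). Qed.

Lemma cocycleP A l (x : A l) :
  reflect (forall k (e : l + 1 = k), cdiff A e x = 0) (x \in @cocycle K A l).
Proof.
apply: (iffP idP) => [|h]; last by rewrite inE; apply/eqP; exact: h.
by rewrite inE => /eqP x0 k e; subst k.
Qed.

(** Injectivity and surjectivity on cohomology, expressed on cochains. The degrees are free
    variables tied by equations, so the conditions pass to suspensions without transport. *)
Lemma quasi_iso_criterion A B (f : chain_map A B) :
  (forall (i j k : int) (e : i + 1 = j) (e' : j + 1 = k) (x : A j) (y : B i),
     cdiff A e' x = 0 -> f j x = cdiff B e y -> exists y', x = cdiff A e y') ->
  (forall (i j k : int) (e : i + 1 = j) (e' : j + 1 = k) (y : B j),
     cdiff B e' y = 0 ->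
     exists x z, cdiff A e' x = 0 /\ y = f j x + cdiff B e z) ->
  quasi_iso f.
Proof.
move=> inj surj l.
pose g := cohom_chain_map f l.
have ginj a : g a = 0 -> a = 0.
  move: a; apply: cohom_ind => z.
  rewrite /g cohom_chain_mapE -(linear0 (cohom_class B l)).
  move=> /cohom_class_eq; rewrite subr0 => /coboundaryP[i [e [y yz]]].
  have z0 := elimT (cocycleP _) (cocycle_valP z) _ (erefl (l + 1)).
  have [y' y'z] := inj i l _ e erefl _ y z0 (esym yz).
  rewrite -(linear0 (cohom_class A l)); apply/cohom_class_eq; rewrite subr0.
  by apply/coboundaryP; exists i, e, y'.
(* [bijective] asks for an inverse function, so preimages are chosen; injectivity of [g] then makes
   the choice a left inverse too. *)
have /choice[h hP] b : exists a, g a = b.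
  move: b; apply: cohom_ind => z.
  have z0 := elimT (cocycleP _) (cocycle_valP z) _ (erefl (l + 1)).
  have [x [w [x0 zE]]] := surj (l - 1) l _ (subrK 1 l) erefl _ z0.
  have xc : x \in @cocycle K A l by rewrite inE; apply/eqP.
  exists (cohom_class A l (Cocycle xc)); rewrite /g cohom_chain_mapE.
  apply/esym/cohom_class_eq/coboundaryP; exists (l - 1), (subrK 1 l), w.
  by rewrite !linearB /= zE [RHS]addrAC subrr add0r.
exists h => [a|b]; last exact: hP.
by apply/eqP; rewrite -subr_eq0; apply/eqP/ginj; rewrite linearB hP subrr.
Qed.

End CohomologyFunctor.

(** * The action of u on cohomology and the functors nu^k *)

Section CohomologyAction.
Variables (R : realType) (K : fieldType) (M : dgmod K).

Lemma cohom_upow0 (i : int) (e : i + 2 * 0%N%:Z = i) a : cohom_upow M e a = a.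
Proof.
move: a; apply: cohom_ind => z; rewrite cohom_upowE; congr (cohom_class _ _ _).
by apply: val_inj; exact: upow0.
Qed.

Lemma cohom_upowD m n p (i j k : int) (e1 : i + 2 * m%:Z = j)
    (e2 : j + 2 * n%:Z = k) (e3 : i + 2 * p%:Z = k) a :
  cohom_upow M e2 (cohom_upow M e1 a) = cohom_upow M e3 a.
Proof.
move: a; apply: cohom_ind => z; rewrite !cohom_upowE; congr (cohom_class _ _ _).
by apply: val_inj; exact: upowD.
Qed.

(** The power u^0 serves as transport between degrees that are equal but not convertible. *)
Lemma cohom_upowK (i j : int) (e1 : i + 2 * 0%N%:Z = j)
    (e2 : j + 2 * 0%N%:Z = i) :
  cancel (cohom_upow M e1) (cohom_upow M e2).
Proof.
have e3 : i + 2 * 0%N%:Z = i by lia.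
by move=> a; rewrite (cohom_upowD _ _ e3) cohom_upow0.
Qed.

Lemma cohom_upow_eq m n (i j : int) (e : i + 2 * m%:Z = j)
    (e' : i + 2 * n%:Z = j) a :
  cohom_upow M e a = cohom_upow M e' a.
Proof.
have mn : m = n by lia.
by subst n; rewrite (eq_irrelevance e e').
Qed.

Lemma floor_upow_eq_floor (i : int) (r s : R) : Num.floor r <= Num.floor s ->
  i + 2 * Num.floor r + 2 * `|Num.floor s - Num.floor r|%N%:Z
  = i + 2 * Num.floor s.
Proof. by move=> h; lia. Qed.

(** The exponent of u makes sense as soon as the floors are ordered. The underlying functor is
    [nu k M] itself, so [dI_attained] applies to it. *)
Definition nu_floor (k : int) : floor_rfun R (Vect K).
Proof.
refine (@FloorRFun R (Vect K) (nu k M)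
  (fun r s h => cohom_upow M (floor_upow_eq_floor k h)) _ _).
- by move=> r s h h'; apply: linear_ext => a; exact: cohom_upow_eq.
- by move=> r s t h1 h2 h3; apply: linear_ext => a; exact: cohom_upowD.
Defined.

Lemma nu_shift_eq (k j : int) (r : R) :
  k + 2 * Num.floor (r + j%:~R) + 2 * 0%N%:Z = k + 2 * j + 2 * Num.floor r.
Proof.
have -> : Num.floor (r + j%:~R) = Num.floor r + j.
  by rewrite floorDrz ?intr_int // intrKfloor.
lia.
Qed.

(** The floor commutes with adding the integer [j], so both sides have the same degrees and u^0
    compares them. This reaches every degree from degrees 0 and 1. *)
Lemma nu_shift (k j : int) :
  nat_iso (rshift j%:~R (nu k M)) (@nu K R (k + 2 * j) M).
Proof.
pose F : rfun R (Vect K) := rshift j%:~R (nu k M).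
pose G : rfun R (Vect K) := nu (k + 2 * j) M.
pose f r : hom (F r) (G r) := cohom_upow M (nu_shift_eq k j r).
have n r s (h : r <= s) : compm (f s) (rmap F h) = compm (rmap G h) (f r).
  apply: linear_ext => a /=.
  have e : k + 2 * Num.floor (r + j%:~R)
      + 2 * `|Num.floor s - Num.floor r|%N%:Z = k + 2 * j + 2 * Num.floor s.
    have := le_floor h; have := nu_shift_eq k j r; lia.
  transitivity (cohom_upow M e a); [|symmetry].
    exact: (cohom_upowD (floor_upow_eq k (rshift_le j%:~R h))
      (nu_shift_eq k j s)).
  exact: (cohom_upowD (nu_shift_eq k j r) (floor_upow_eq _ h)).
apply: (@nat_iso_bij _ _ F G (@NatTrans R (Vect K) F G f n)) => r.
have e : k + 2 * j + 2 * Num.floor r + 2 * 0%N%:Z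
    = k + 2 * Num.floor (r + j%:~R).
  by have := nu_shift_eq k j r; lia.
by exists (cohom_upow M e); exact: cohom_upowK.
Qed.

Lemma csuspend_cocycle (l k : int) (x : csuspend l M k) :
  (x \in @cocycle K (csuspend l M) k) = (x \in @cocycle K M (k + l)).
Proof.
apply/cocycleP/cocycleP => h j e; last exact: h.
have e' : k + 1 = j - l by lia.
have := h _ e'; rewrite /=.
have jE : j = j - l + l by lia.
by case: _ / jE (csuspend_eq l e') => e2; rewrite (cdiff_irr e2 e).
Qed.

Lemma csuspend_coboundary (l k : int) (z : cocycles (csuspend l M) k)
    (z' : cocycles M (k + l)) :
  val z' = val z ->
  (z \in @coboundary K (csuspend l M) k) = (z' \in @coboundary K M (k + l)).
Proof.
move=> zz; apply/coboundaryP/coboundaryP => [[i [e [y yz]]]|[i [e [y yz]]]].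
  by exists (i + l), (csuspend_eq l e), y; rewrite zz.
have e' : i - l + 1 = k by lia.
exists (i - l), e'; rewrite -zz -yz.
(* Quantifying over [y] allows the degree [i] to be replaced by [i - l + l]. *)
suff : forall y : M i, exists y' : M (i - l + l),
  cdiff M (csuspend_eq l e') y' = cdiff M e y by apply.
have iE : i = i - l + l by lia.
case: _ / iE (csuspend_eq l e') => e2 w; exists w; exact: cdiff_irr.
Qed.

(** The comparison is induced by the identity on cochains. Cocycles of the suspension and of [M] are
    cut out by differentials into degrees that are only provably equal, hence an isomorphism and not
    an equality. *)
Lemma cohom_alpha (k : int) : nat_iso (cohom_rfun k (alpha R M)) (nu k M).
Proof.
pose A (r : R) := csuspend (2 * Num.floor r) M.
pose F := cohom_rfun k (alpha R M); pose G : rfun R (Vect K) := nu k M.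
have c1 (r : R) (x : A r k) : x \in @cocycle K (A r) k ->
    lin_id _ x \in @cocycle K M (k + 2 * Num.floor r).
  by rewrite csuspend_cocycle.
have c2 (r : R) (z : cocycles (A r) k) (z' : cocycles M (k + 2 * Num.floor r)) :
    z \in @coboundary K (A r) k -> val z' = lin_id _ (val z) ->
    z' \in @coboundary K M (k + 2 * Num.floor r).
  by move=> zb /csuspend_coboundary <-.
pose f (r : R) : hom (F r) (G r) := cohom_map (@c1 r) (@c2 r).
have fE (r : R) (z : cocycles (A r) k) :
    f r (cohom_class _ _ z) = cohom_class M _ (cocycles_map (@c1 r) z).
  exact: (cohom_map_funE (@c1 r) (@c2 r)).
have n r s (h : r <= s) : compm (f s) (rmap F h) = compm (rmap G h) (f r).
  apply: linear_ext; apply: cohom_ind => z.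
  change (f s (cohom_chain_map (alpha_map M h) k (cohom_class (A r) k z))
    = cohom_upow M (floor_upow_eq k h) (f r (cohom_class (A r) k z))).
  rewrite cohom_chain_mapE !fE cohom_upowE; congr (cohom_class _ _ _).
  exact: val_inj.
apply: (@nat_iso_bij _ _ F G (@NatTrans R (Vect K) F G f n)) => r /=.
have gc (b : cohom M (k + 2 * Num.floor r)) :
    val (repr b) \in @cocycle K (A r) k.
  by rewrite csuspend_cocycle; exact: cocycle_valP.
pose g b := cohom_class (A r) k (Cocycle (gc b)).
have fK : cancel g (f r).
  move=> b; rewrite /g fE -[RHS]cohom_class_repr; congr (cohom_class _ _ _).
  exact: val_inj.
have f_inj a : f r a = 0 -> a = 0.
  move: a; apply: cohom_ind => z; rewrite fE -(linear0 (cohom_class _ _)).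
  move=> /cohom_class_eq; rewrite subr0 => h.
  rewrite -(linear0 (cohom_class _ _)); apply/cohom_class_eq; rewrite subr0.
  by rewrite (csuspend_coboundary (z' := cocycles_map (@c1 r) z)).
exists g => // a; apply/eqP; rewrite -subr_eq0; apply/eqP/f_inj.
by rewrite linearB [X in X - _]fK subrr.
Qed.

End CohomologyAction.

(** * Morphisms of dg modules *)


Section DependentProduct.
Variables (K : fieldType) (I : Type) (V : I -> lmodType K).

(** The index type is arbitrary because it will also be a type of proofs of an equation between
    degrees. *)
Definition dprod := forall i, V i.

HB.instance Definition _ := gen_eqMixin dprod.
HB.instance Definition _ := gen_choiceMixin dprod.

Implicit Types f g : dprod.
Let zero : dprod := fun=> 0.
Let opp f : dprod := fun i => - f i.
Let add f g : dprod := fun i => f i + g i.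
Let scale c f : dprod := fun i => c *: f i.

Let dprodP f g : (forall i, f i = g i) -> f = g.
Proof. exact: functional_extensionality_dep. Qed.

Let addA : associative add.
Proof. by move=> f g h; apply: dprodP => i; exact: addrA. Qed.
Let addC : commutative add.
Proof. by move=> f g; apply: dprodP => i; exact: addrC. Qed.
Let add0 : left_id zero add.
Proof. by move=> f; apply: dprodP => i; exact: add0r. Qed.
Let addN : left_inverse zero opp add.
Proof. by move=> f; apply: dprodP => i; exact: addNr. Qed.

HB.instance Definition _ := GRing.isZmodule.Build dprod addA addC add0 addN.

Let scaleA a b f : scale a (scale b f) = scale (a * b) f.
Proof. by apply: dprodP => i; exact: scalerA. Qed.
Let scale1 : left_id 1 scale.
Proof. by move=> f; apply: dprodP => i; exact: scale1r. Qed.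
Let scaleDr : right_distributive scale +%R.
Proof. by move=> c f g; apply: dprodP => i; exact: scalerDr. Qed.
Let scaleDl f : {morph scale^~ f : a b / a + b}.
Proof. by move=> a b; apply: dprodP => i; exact: scalerDl. Qed.

HB.instance Definition _ := GRing.Zmodule_isLmodule.Build K dprod
  scaleA scale1 scaleDr scaleDl.

End DependentProduct.

Definition mk_linear (K : fieldType) (U V : lmodType K) (f : U -> V)
  (fl : linear f) : {linear U -> V} :=
  HB.pack f (GRing.isLinear.Build K U V _ f fl).

(** * Maps of dg modules and the transformations they induce on alpha *)

Section DGMaps.
Variables (R : realType) (K : fieldType).

Lemma dgu_upow (M : dgmod K) (i j : int) (e : i + 2 = j)
    (e' : i + 2 * 1%N%:Z = j) x :
  dgu M e x = upow M e' x.
Proof. by rewrite (upowS e' (addr0 i) e) upow0. Qed.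

Record dgmap (M N : dgmod K) := DGMap {
  dgmap_chain :> chain_map M N;
  dgmap_u : forall (i j : int) (e : i + 2 = j) x,
    dgmap_chain j (dgu M e x) = dgu N e (dgmap_chain i x) }.

Section AlphaMap.
Variables (M N : dgmod K) (f : dgmap M N).

Lemma dgmap_upow n (i j : int) (e : i + 2 * n%:Z = j) x :
  f j (upow M e x) = upow N e (f i x).
Proof.
elim: n j e => [|n IHn] j e.
  have ij : i = j by lia.
  by case: j / ij e => e; rewrite !upow0.
have e' : i + 2 * n%:Z + 2 = j by lia.
by rewrite !(upowS e erefl e') dgmap_u IHn.
Qed.

Definition alpha_nt : nat_trans (alpha R M) (alpha R N).
Proof.
refine (@NatTrans R (Ch K) (alpha R M) (alpha R N) (fun r =>
  @ChainMap K (csuspend (2 * Num.floor r) M) (csuspend (2 * Num.floor r) N)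
   (fun i => f (i + 2 * Num.floor r)) _) _).
move=> r s h; apply: chain_map_ext => i x; exact: dgmap_upow.
Unshelve.
by move=> i j e x; exact: (chmap_diff f (csuspend_eq _ e)).
Defined.

Hypothesis f_inj : forall (i j k : int) (e : i + 1 = j) (e' : j + 1 = k)
  (x : M j) (y : N i), cdiff M e' x = 0 -> f j x = cdiff N e y ->
  exists y', x = cdiff M e y'.
Hypothesis f_surj : forall (i j k : int) (e : i + 1 = j) (e' : j + 1 = k)
  (y : N j), cdiff N e' y = 0 ->
  exists x z, cdiff M e' x = 0 /\ y = f j x + cdiff N e z.

Lemma alpha_weq : weq alpha_nt.
Proof.
move=> r; apply: quasi_iso_criterion => i j k e e'.
  exact: (@f_inj _ _ _ (csuspend_eq _ e) (csuspend_eq _ e')).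
exact: (@f_surj _ _ _ (csuspend_eq _ e) (csuspend_eq _ e')).
Qed.

End AlphaMap.
End DGMaps.

(** * Cohomology as a dg module, and the projection onto it *)

Section Formality.
Variables (K : fieldType) (M : dgmod K).

Definition cohom_cochain : cochain K :=
  @Cochain K (cohom M) (fun i j e => \0) (fun i j k e e' x => erefl).

Lemma mul2_1 (i j : int) : i + 2 = j -> i + 2 * 1%N%:Z = j.
Proof. by lia. Qed.

Definition cohom_dgmod : dgmod K.
Proof.
refine (@DGMod K cohom_cochain (fun i j e => cohom_upow M (mul2_1 e)) _).
by move=> i j k l e1 e2 e3 e4 x; exact: (linear0 (cohom_upow M (mul2_1 e2))).
Defined.

Lemma cohom_dgmod_upow n (i j : int) (e : i + 2 * n%:Z = j) x :
  upow cohom_dgmod e x = cohom_upow M e x.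
Proof.
elim: n j e => [|n IHn] j e.
  have ij : i = j by lia.
  by case: j / ij e => e; rewrite upow0 cohom_upow0.
have e' : i + 2 * n%:Z + 2 = j by lia.
rewrite (upowS e erefl e') IHn; exact: cohom_upowD.
Qed.

(** The inclusion of the cocycles is injective, so the class map extends along it to all
    cochains. *)
Lemma cohom_projection (k : int) : exists p : {linear M k -> cohom M k},
  forall z : cocycles M k, p (val z) = cohom_class M k z.
Proof.
apply: (@linear_factor K _ _ _ (val : {linear cocycles M k -> M k})
  (cohom_class M k)).
move=> z z0; have -> : z = 0 by apply: val_inj; rewrite z0 linear0.
exact: linear0.
Qed.

Definition cproj k := sval (cid (cohom_projection k)).

Lemma cprojE k z : cproj k (val z) = cohom_class M k z.
Proof. exact: svalP (cid (cohom_projection k)) z. Qed.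

Lemma cproj_diff (i j : int) (e : i + 1 = j) x : cproj j (cdiff M e x) = 0.
Proof.
have c : cdiff M e x \in @cocycle K M j by rewrite inE cdiffK.
rewrite -[cdiff M e x]/(val (Cocycle c)) cprojE -(linear0 (cohom_class M j)).
by apply/cohom_class_eq; rewrite subr0; apply/coboundaryP; exists i, e, x.
Qed.

Lemma cproj_upow n (i j : int) (e : i + 2 * n%:Z = j) (z : cocycles M i) :
  cproj j (upow M e (val z)) = cohom_upow M e (cohom_class M i z).
Proof. by rewrite cohom_upowE -cprojE. Qed.

Lemma subr2_eq (k : int) : k - 2 + 2 * 1%N%:Z = k.
Proof. by lia. Qed.

(* The failure of [cproj] to commute with u vanishes on cocycles, hence factors
   through the differential. *)
Lemma cohom_homotopy (i j : int) (e : i + 1 = j) :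
  exists h : {linear M i -> cohom M j},
    forall (k : int) (e1 : k + 1 = i) (e2 : k + 2 * 1%N%:Z = j) x,
    h (cdiff M e1 x) = cproj j (upow M e2 x) - cohom_upow M e2 (cproj k x).
Proof.
have e1 : i - 1 + 1 = i by lia.
have e2 : i - 1 + 2 * 1%N%:Z = j by lia.
pose d x := cproj j (upow M e2 x) - cohom_upow M e2 (cproj (i - 1) x).
have d_lin : linear d.
  by move=> c x y; rewrite /d !linearD !linearZZ addrACA.
have [|h hE] := @linear_factor K _ _ _ (cdiff M e1) (mk_linear d_lin).
  move=> x x0; have xc : x \in @cocycle K M (i - 1).
    apply/cocycleP => k ek; have ki : i = k by lia.
    by case: _ / ki ek => ek; rewrite (cdiff_irr ek e1).
  by rewrite /= /d -[x]/(val (Cocycle xc)) cproj_upow cprojE subrr.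
exists h => k e1' e2' x; have kE : k = i - 1 by lia.
by subst k; rewrite (eq_irrelevance e1' e1) (eq_irrelevance e2' e2) hE.
Qed.

End Formality.

(** * Formality *)


Section Tower.
Variables (K : fieldType) (M : dgmod K).

Definition chomotopy (i j : int) (e : i + 1 = j) : {linear M i -> cohom M j} :=
  sval (cid (cohom_homotopy M e)).

Lemma chomotopyE (i j k : int) (e : i + 1 = j) (e1 : k + 1 = i)
    (e2 : k + 2 * 1%N%:Z = j) x :
  chomotopy e (cdiff M e1 x)
  = cproj M j (upow M e2 x) - cohom_upow M e2 (cproj M k x).
Proof. exact: (svalP (cid (cohom_homotopy M e))). Qed.

Lemma chomotopy_upow (l i i' j : int) (e : i + 1 = j) (e' : i' + 1 = j) n n'
    (e1 : l + 2 * n%:Z = i) (e2 : l + 2 * n'%:Z = i') x :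
  chomotopy e (upow M e1 x) = chomotopy e' (upow M e2 x).
Proof.
have ii : i = i' by lia.
have nn : n = n' by lia.
subst n'; case: _ / ii e' e2 => e' e2.
by rewrite (eq_irrelevance e e') (eq_irrelevance e1 e2).
Qed.

(** The factor H^(l + 2n) is encoded by families over [j] and a proof of l + 2n = j. Such proofs are
    unique, so the space is the same, and a component can be read in any provably equal degree
    without transport. *)
Definition tower0 (l : int) := dprod (fun n : nat => dprod (fun j : int =>
  dprod (fun _ : l + 2 * n%:Z = j => cohom M j))).

Definition tower1 (l : int) := dprod (fun n : nat => dprod (fun j : int =>
  dprod (fun _ : l + 2 * n%:Z + 1 = j => cohom M j))).

(** Total complex of the two-term coinduced resolution of H(M): a sequence (a_n) is the K-linear map
    u^n |-> a_n on K[u], and the differential measures its failure to be K[u]-linear. *)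
Definition tower_obj (l : int) : lmodType K := (tower0 l * tower1 l)%type.

Lemma tower_ext l (x y : tower_obj l) :
  (forall n j e, x.1 n j e = y.1 n j e) ->
  (forall n j e, x.2 n j e = y.2 n j e) -> x = y.
Proof.
move=> h1 h2; apply: injective_projections;
  do 3![apply: functional_extensionality_dep => ?].
  exact: h1.
exact: h2.
Qed.

Lemma tower_eq0S (i j k : int) n : i + 1 = j -> j + 2 * n%:Z + 1 = k ->
  i + 2 * n.+1%:Z = k.
Proof. by lia. Qed.

Lemma tower_eq0 (i j k : int) n : i + 1 = j -> j + 2 * n%:Z + 1 = k ->
  i + 2 * n%:Z = k - 2.
Proof. by lia. Qed.

Definition tower_diff_fun (i j : int) (e : i + 1 = j) (x : tower_obj i) :
  tower_obj j :=
  (0, fun n k e' => x.1 n.+1 k (tower_eq0S e e')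
    - cohom_upow M (subr2_eq k) (x.1 n (k - 2) (tower_eq0 e e'))).

Lemma tower_diff_linear i j (e : i + 1 = j) : linear (tower_diff_fun e).
Proof.
have sub_linear (U V : lmodType K) (f : {linear U -> V}) c a b a' b' :
    c *: a + a' - f (c *: b + b') = c *: (a - f b) + (a' - f b').
  by rewrite linearD linearZZ opprD addrACA scalerBr.
move=> c x y; apply: tower_ext => n k e'.
  by rewrite /= [RHS]addr0 [RHS]scaler0.
exact: (sub_linear _ _ (cohom_upow M (subr2_eq k)) c (x.1 n.+1 k _)
  (x.1 n (k - 2) _) (y.1 n.+1 k _) (y.1 n (k - 2) _)).
Qed.

Definition tower_diff i j (e : i + 1 = j) :
  {linear tower_obj i -> tower_obj j} := mk_linear (tower_diff_linear e).

Lemma tower_diff1 i j (e : i + 1 = j) x : (tower_diff e x).1 = 0.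
Proof. by []. Qed.

Lemma tower_diff2 i j (e : i + 1 = j) x n k e1 :
  (tower_diff e x).2 n k e1 = x.1 n.+1 k (tower_eq0S e e1)
    - cohom_upow M (subr2_eq k) (x.1 n (k - 2) (tower_eq0 e e1)).
Proof. by []. Qed.

Lemma tower_diffK i j k (e : i + 1 = j) (e' : j + 1 = k) x :
  tower_diff e' (tower_diff e x) = 0.
Proof.
apply: tower_ext => n l e1; first by [].
by rewrite tower_diff2 tower_diff1 [X in X - _]/= sub0r linear0 oppr0.
Qed.

Definition tower_cochain : cochain K :=
  @Cochain K tower_obj tower_diff tower_diffK.

Lemma tower_equ0 (i j k : int) n : i + 2 = j -> j + 2 * n%:Z = k ->
  i + 2 * n.+1%:Z = k.
Proof. by lia. Qed.

Lemma tower_equ1 (i j k : int) n : i + 2 = j -> j + 2 * n%:Z + 1 = k ->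
  i + 2 * n.+1%:Z + 1 = k.
Proof. by lia. Qed.

Definition tower_u_fun (i j : int) (e : i + 2 = j) (x : tower_obj i) :
  tower_obj j :=
  (fun n k e' => x.1 n.+1 k (tower_equ0 e e'),
   fun n k e' => x.2 n.+1 k (tower_equ1 e e')).

Lemma tower_u_linear i j (e : i + 2 = j) : linear (tower_u_fun e).
Proof. by []. Qed.

Definition tower : dgmod K.
Proof.
refine (@DGMod K tower_cochain (fun i j e => mk_linear (tower_u_linear e)) _).
move=> i j k l e1 e2 e3 e4 x; apply: tower_ext => n m e; first by [].
have irr p p' q q' :
    x.1 n.+2 m p - cohom_upow M (subr2_eq m) (x.1 n.+1 (m - 2) q)
    = x.1 n.+2 m p' - cohom_upow M (subr2_eq m) (x.1 n.+1 (m - 2) q').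
  by rewrite (eq_irrelevance p p') (eq_irrelevance q q').
exact: irr.
Defined.

(** Vanishing of the differential means a_(n+1) = u a_n, so the first sequence is generated by
    a_0. *)
Lemma tower_cocycle (i j : int) (e : i + 1 = j) (x : tower i) :
  cdiff tower e x = 0 ->
  forall n k (e1 : i + 2 * n%:Z = k) (e0 : i + 2 * 0%N%:Z = i),
  x.1 n k e1 = cohom_upow M e1 (x.1 0%N i e0).
Proof.
move=> dx n k e1 e0; elim: n k e1 => [|n IHn] k e1.
  have ik : i = k by lia.
  by case: _ / ik e1 => e1; rewrite cohom_upow0 (eq_irrelevance e1 e0).
have e2 : j + 2 * n%:Z + 1 = k by lia.
have := congr1 (fun y : tower j => y.2 n k e2) dx.
rewrite [LHS]tower_diff2 => /eqP; rewrite [X in _ == X]/= subr_eq0 => /eqP.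
rewrite (eq_irrelevance (tower_eq0S e e2) e1) => ->.
by rewrite IHn; exact: cohom_upowD.
Qed.

Lemma tower_eq1 (i j k : int) n : i + 1 = j -> i + 2 * n.+1%:Z = k ->
  j + 2 * n%:Z + 1 = k.
Proof. by lia. Qed.

Lemma tower_eq2 (i k : int) n : i + 2 * n.+1%:Z = k -> i + 2 * n%:Z = k - 2.
Proof. by lia. Qed.

(** A primitive of (0, b): the solution of a_(n+1) - u a_n = b_n starting from a_0 = 0. *)
Fixpoint tower_fill (i j : int) (e : i + 1 = j) (b : tower1 j) (n : nat) :
    forall k, i + 2 * n%:Z = k -> cohom M k :=
  match n return forall k, i + 2 * n%:Z = k -> cohom M k with
  | 0%N => fun k _ => 0
  | m.+1 => fun k e' => b m k (tower_eq1 e e')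
      + cohom_upow M (subr2_eq k) (tower_fill e b (tower_eq2 e'))
  end.

Lemma tower_coboundary (i j : int) (e : i + 1 = j) (x : tower j) :
  x.1 = 0 -> exists y, x = cdiff tower e y.
Proof.
move=> x0; exists (fun n k e' => tower_fill e x.2 e', 0).
apply: tower_ext => n k e'; first by rewrite x0.
rewrite [RHS]tower_diff2 /=.
rewrite (eq_irrelevance (tower_eq2 _) (tower_eq0 e e')) addrK.
by congr (x.2 _ _ _); exact: eq_irrelevance.
Qed.

Definition to_tower_fun (i : int) (x : M i) : tower i :=
  (fun n k e => cproj M k (upow M e x),
   fun n k e => chomotopy e (upow M (erefl (i + 2 * n%:Z)) x)).

Lemma to_tower_linear i : linear (@to_tower_fun i).
Proof.
have lin_comp2 (U V W : lmodType K) (f : {linear U -> V})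
    (g : {linear V -> W}) c a b : g (f (c *: a + b)) = c *: g (f a) + g (f b).
  by rewrite !linearD !linearZZ.
move=> c x y; apply: tower_ext => n k e.
  exact: (lin_comp2 _ _ _ (upow M e) (cproj M k)).
exact: (lin_comp2 _ _ _ (upow M erefl) (chomotopy e)).
Qed.

(** The first sequence vanishes because p kills boundaries. In the second, h d = p u - u p applied
    to u^n x gives exactly the differential of the tower. *)
Lemma to_tower_diff i j (e : i + 1 = j) x :
  mk_linear (@to_tower_linear j) (cdiff M e x)
  = cdiff tower e (mk_linear (@to_tower_linear i) x).
Proof.
apply: tower_ext => n k e'.
  have e1 : k - 1 + 1 = k by lia.
  have e2 : i + 2 * n%:Z = k - 1 by lia.
  by rewrite /= (upow_diff e e' e2 e1) cproj_diff.
rewrite [RHS]tower_diff2 /=.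
have e1 : i + 2 * n%:Z + 1 = j + 2 * n%:Z by lia.
have e2 : i + 2 * n%:Z + 2 * 1%N%:Z = k by lia.
rewrite (upow_diff e erefl erefl e1) (chomotopyE _ _ e2).
rewrite (upowD _ _ (tower_eq0S e e')); congr (_ - _).
have irr (l l' : int) (a : l + 2 * 1%N%:Z = k) (a' : l' + 2 * 1%N%:Z = k)
    (b : i + 2 * n%:Z = l) (b' : i + 2 * n%:Z = l') :
  cohom_upow M a (cproj M l (upow M b x))
  = cohom_upow M a' (cproj M l' (upow M b' x)).
  have ll : l = l' by lia.
  case: _ / ll a' b' => a' b'.
  by rewrite (eq_irrelevance a a') (eq_irrelevance b b').
exact: irr.
Qed.

Lemma to_tower_u i j (e : i + 2 = j) x :
  mk_linear (@to_tower_linear j) (dgu M e x)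
  = dgu tower e (mk_linear (@to_tower_linear i) x).
Proof.
have e1 : i + 2 * 1%N%:Z = j by lia.
rewrite (dgu_upow _ e1); apply: tower_ext => n k e'.
  exact: (congr1 (cproj M k) (upowD e1 e' (tower_equ0 e e') x)).
have e2 : i + 2 * n.+1%:Z = j + 2 * n%:Z by lia.
apply: etrans (congr1 (chomotopy e') (upowD e1 erefl e2 x)) _.
exact: chomotopy_upow.
Qed.

Definition to_tower : dgmap M tower :=
  DGMap (dgmap_chain := ChainMap to_tower_diff) to_tower_u.

Definition cohom_tower_fun (i : int) (x : cohom M i) : tower i :=
  (fun n k e => cohom_upow M e x, 0).

Lemma cohom_tower_linear i : linear (@cohom_tower_fun i).
Proof.
move=> c x y; apply: tower_ext => n k e; first exact: linearP.
by rewrite /= [RHS]addr0 [RHS]scaler0.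
Qed.

Lemma cohom_tower_diff i j (e : i + 1 = j) x :
  mk_linear (@cohom_tower_linear j) (cdiff (cohom_dgmod M) e x)
  = cdiff tower e (mk_linear (@cohom_tower_linear i) x).
Proof.
apply: tower_ext => n k e'; first exact: (linear0 (cohom_upow M _)).
apply/esym/eqP; rewrite [X in X == _]tower_diff2 [X in _ == X]/= subr_eq0.
apply/eqP/esym; exact: cohom_upowD.
Qed.

Lemma cohom_tower_u i j (e : i + 2 = j) x :
  mk_linear (@cohom_tower_linear j) (dgu (cohom_dgmod M) e x)
  = dgu tower e (mk_linear (@cohom_tower_linear i) x).
Proof. by apply: tower_ext => n k e'; [exact: cohom_upowD|]. Qed.

Definition cohom_tower : dgmap (cohom_dgmod M) tower :=
  DGMap (dgmap_chain := ChainMap cohom_tower_diff) cohom_tower_u.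

Variable R : realType.

Lemma to_tower_weq : weq (alpha_nt R to_tower).
Proof.
apply: alpha_weq => i j k e e'.
  move=> x y dx xy.
  (* Entry 0 of the first sequence is the class of [x], and it vanishes on coboundaries of the
     tower; hence [x] is a boundary. *)
  have e0 : j + 2 * 0%N%:Z = j by lia.
  have := congr1 (fun t : tower j => t.1 0%N j e0) xy; rewrite /= upow0.
  have xc : x \in @cocycle K M j.
    apply/cocycleP => l el; have kl : k = l by lia.
    by case: _ / kl el => el; rewrite (cdiff_irr el e').
  rewrite -[x]/(val (Cocycle xc)) cprojE -[RHS](linear0 (cohom_class M j)).
  move=> /cohom_class_eq; rewrite subr0 => /coboundaryP[l [el [z <-]]].
  have li : l = i by lia.
  by subst l; exists z; exact: cdiff_irr.
move=> y dy.
have e0 : j + 2 * 0%N%:Z = j by lia.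
(* The first sequence of a cocycle is determined by its entry 0, so subtracting the image of a
   representative of that class leaves only a second component, which is a coboundary. *)
pose z := repr (y.1 0%N j e0).
have [w wE] : exists w, y - to_tower j (val z) = cdiff tower e w.
  apply: tower_coboundary; do 3![apply: functional_extensionality_dep => ?].
  apply/eqP; rewrite [X in X == _]/= subr_eq0; apply/eqP.
  by rewrite (tower_cocycle dy _ e0) cproj_upow cohom_class_repr.
exists (val z), w; split; last by rewrite -wE addrC subrK.
exact: elimT (cocycleP _) (cocycle_valP z) _ e'.
Qed.

Lemma cohom_tower_weq : weq (alpha_nt R cohom_tower).
Proof.
apply: alpha_weq => i j k e e'.
  (* H(M) has zero differential, so [x] itself must vanish; it is entry 0 of its image, which is a
     coboundary. *)
  move=> x y dx xy; exists 0; rewrite linear0.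
  have e0 : j + 2 * 0%N%:Z = j by lia.
  have := congr1 (fun t : tower j => t.1 0%N j e0) xy.
  by rewrite /= cohom_upow0.
move=> y dy.
have e0 : j + 2 * 0%N%:Z = j by lia.
have [w wE] : exists w, y - cohom_tower j (y.1 0%N j e0) = cdiff tower e w.
  apply: tower_coboundary; do 3![apply: functional_extensionality_dep => ?].
  apply/eqP; rewrite [X in X == _]/= subr_eq0; apply/eqP.
  exact: (tower_cocycle dy _ e0).
by exists (y.1 0%N j e0), w; split=> //; rewrite -wE addrC subrK.
Qed.

Lemma alpha_formal : zigzag_weq (alpha R M) (alpha R (cohom_dgmod M)).
Proof.
apply: (rst_trans _ _ _ (alpha R tower)).
  by apply: rst_step; exists (alpha_nt R to_tower); exact: to_tower_weq.
apply: rst_sym; apply: rst_step.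
by exists (alpha_nt R cohom_tower); exact: cohom_tower_weq.
Qed.

End Tower.

(** * Assembling interleavings *)


Section CohomologyInterleaving.
Variables (R : realType) (K : fieldType).
Implicit Types M N : dgmod K.

(** Dividing the degree by 2 leaves remainder 0 or 1, and the quotient is absorbed by an integer
    shift of the parameter. *)
Lemma nu_interleaved e M N : interleaved e (@nu K R 0 M) (nu 0 N) ->
  interleaved e (@nu K R 1 M) (nu 1 N) ->
  forall i : int, interleaved e (@nu K R i M) (nu i N).
Proof.
move=> h0 h1 i; have [j [k [-> h]]] : exists j k : int,
    i = k + 2 * j /\ interleaved e (@nu K R k M) (nu k N).
  exists (i %/ 2)%Z, (i %% 2)%Z; split; first by rewrite addrC mulrC -divz_eq.
  have : (i %% 2)%Z = 0 \/ (i %% 2)%Z = 1 by lia.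
  by case=> ->.
apply: interleaved_iso (interleaved_shift j%:~R h); exact: nu_shift.
Qed.

(** The differentials vanish, so any degreewise family of linear maps is a chain map; naturality
    holds degree by degree. *)
Definition cohom_alpha_nt e M N
  (f : forall i : int, nat_trans (@nu K R i M) (rshift e (nu i N))) :
  nat_trans (alpha R (cohom_dgmod M)) (rshift e (alpha R (cohom_dgmod N))).
Proof.
refine (@NatTrans R (Ch K) (alpha R (cohom_dgmod M))
  (rshift e (alpha R (cohom_dgmod N))) (fun r =>
  @ChainMap K (alpha R (cohom_dgmod M) r) (alpha R (cohom_dgmod N) (r + e))
    (fun i => f i r) _) _).
move=> r s h; apply: chain_map_ext => i x.
apply: etrans (congr1 (f i s) (cohom_dgmod_upow (floor_upow_eq i h) x)) _.
apply: etrans (esym (cohom_dgmod_upow (floor_upow_eq i (rshift_le e h)) _)).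
exact: (congr1 (fun t : {linear _ -> _} => t x) (nt_nat (f i) h)).
Unshelve.
by move=> i j e' x; exact: (linear0 (f j r)).
Defined.

Lemma cohom_alpha_interleaved e M N : 0 <= e ->
  (forall i : int, interleaved e (@nu K R i M) (nu i N)) ->
  interleaved e (alpha R (cohom_dgmod M)) (alpha R (cohom_dgmod N)).
Proof.
move=> e0 MN; apply/interleavedP; split=> //.
(* Both transformations of a degree are bundled in a pair, so that a single choice over all degrees
   keeps them mutually compatible. *)
have ex i : exists fg : nat_trans (@nu K R i M) (rshift e (nu i N)) *
                        nat_trans (@nu K R i N) (rshift e (nu i M)),
    (forall (r : R) (h : r <= r + e + e),
       compm (fg.2 (r + e)) (fg.1 r) = rmap (nu i M) h) /\
    (forall (r : R) (h : r <= r + e + e),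
       compm (fg.1 (r + e)) (fg.2 r) = rmap (nu i N) h).
  by have /interleavedP[_ [f [g fg]]] := MN i; exists (f, g).
pose fg i := sval (cid (ex i)); have fgP i := svalP (cid (ex i)).
exists (cohom_alpha_nt (fun i => (fg i).1)).
exists (cohom_alpha_nt (fun i => (fg i).2)).
split=> r h; apply: chain_map_ext => i x.
  apply: etrans (esym (cohom_dgmod_upow (floor_upow_eq i h) x)).
  exact: (congr1 (fun t : {linear _ -> _} => t x) ((fgP i).1 r h)).
apply: etrans (esym (cohom_dgmod_upow (floor_upow_eq i h) x)).
exact: (congr1 (fun t : {linear _ -> _} => t x) ((fgP i).2 r h)).
Qed.

End CohomologyInterleaving.

Theorem proposition4p12 (R : realType) (K : fieldType) (M N : dgmod K)
    (fgM : cohom_fg M) (fgN : cohom_fg N)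
    (eps : R) (deps : dCohI R M N = eps%:E) :
  homotopy_interleaved eps (alpha R M) (alpha R N) /\
  (forall delta : R, delta < eps ->
     ~ homotopy_interleaved delta (alpha R M) (alpha R N)).
Proof.
split.
  have eps0 : 0 <= eps.
    by rewrite -lee_fin -deps le_max dI_ge0.
  (* [eps] itself, and not only larger numbers, is an interleaving parameter, since the functors
     depend only on floors. *)
  have attained k : (dI (@nu K R k M) (nu k N) <= eps%:E)%E ->
      interleaved eps (@nu K R k M) (nu k N).
    exact: (@dI_attained R _ eps (nu_floor R M k) (nu_floor R N k) eps0).
  exists (alpha R (cohom_dgmod M)), (alpha R (cohom_dgmod N)).
  split; [exact: alpha_formal|exact: alpha_formal|].
  apply: cohom_alpha_interleaved => //.
  by apply: nu_interleaved; apply: attained; rewrite -deps le_max lexx ?orbT.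
move=> delta lt_delta hi.
(* Cohomology in degree [k] turns the homotopy interleaving into an interleaving of the nu^k; for
   [k] equal to 0 and 1 this bounds the maximum by [delta], below [eps]. *)
have nui k : (dI (@nu K R k M) (nu k N) <= delta%:E)%E.
  apply/dI_le/(interleaved_iso (cohom_alpha R M k) (cohom_alpha R N k)).
  exact: homotopy_interleaved_cohom.
suff : (eps%:E <= delta%:E)%E by rewrite lee_fin leNgt lt_delta.
by rewrite -deps ge_max !nui.
Qed.
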